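(* Let $\Omega=\{\omega_1,\omega_2\}$, $\mathcal F=2^\Omega$, $X(\omega_1)=1$, $X(\omega_2)=0$. Let $\phi$ be a divergence function such that $[1-\delta,1+\delta]\subseteq \mathrm{int}(\mathrm{dom}(\phi))$ for some $\delta>0$ and $\lim_{x\to\infty}\phi(x)/x<\infty$, and let $\tau>0$. Then there exist constants $r_{\phi,\tau}>0$ and $p_{\phi,\tau}>0$, depending only on $\phi$ and $\tau$, with the property that $\mathcal R(X)\ge r_{\phi,\tau}$ for every probability measure $P$ on $(\Omega,\mathcal F)$ with $0<P(\omega_1)\le p_{\phi,\tau}$, and such that the following holds: for any $p\in(0,p_{\phi,\tau})$ there exists a probability measure $P$ on $(\Omega,\mathcal F)$ such that, for every positive integer $n\le 1/(2p)$, $$|\mathcal R_n(X)-\mathcal R(X)|\ge r_{\phi,\tau}$$ with probability at least $1/2$ over the $n$ i.i.d. samples from $P$.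
   Context: A divergence function is a convex lower semicontinuous $\phi:\mathbb R\to[0,\infty]$ with $\phi(1)=0$ and $\phi(x)=+\infty$ for $x<0$. For a probability measure $P$ on a measurable space $(\Omega,\mathcal F)$, a radius $\tau$ and a bounded measurable $X:\Omega\to\mathbb R$, the distributionally robust functional is $$\mathcal R(X)=\mathcal R^P(X)=\sup\Big\{\int_\Omega X\zeta\,dP:\ \zeta\ge 0 \text{ measurable},\ \int_\Omega\zeta\,dP=1,\ \int_\Omega\phi(\zeta)\,dP\le\tau\Big\}.$$ Given i.i.d. samples from $P$, $P_n$ denotes the empirical distribution of $n$ samples, and the sample average approximation is $\mathcal R_n(X)=\mathcal R^{P_n}(X)$, i.e. the same quantity with $P$ replaced by $P_n$ (densities taken with respect to $P_n$). The limit $\lim_{x\to\infty}\phi(x)/x$ always exists in $[0,\infty]$. *)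

(* Defs.v *)
From HB Require Import structures.
From mathcomp Require Import all_boot all_order all_algebra.
From mathcomp Require Import all_classical all_reals all_analysis.

Set Implicit Arguments.
Unset Strict Implicit.
Unset Printing Implicit Defensive.

Import Order.TTheory GRing.Theory Num.Theory.
Import numFieldNormedType.Exports.

Local Open Scope classical_set_scope.
Local Open Scope ring_scope.
Local Open Scope ereal_scope.

Definition edom (R : realType) (phi : R -> \bar R) : set R :=
  [set x | phi x < +oo].

(* In the convexity clause the products use the convention 0 * +oo = 0. *)
Record divergence (R : realType) (phi : R -> \bar R) : Prop := Divergence {
  divergence_ge0 : forall x, 0 <= phi x ;
  divergence_convex : forall (x y t : R), (0 <= t <= 1)%R ->
    phi (t * x + (1 - t) * y)%R <= t%:E * phi x + (1 - t)%:E * phi y ;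
  divergence_lsc : lower_semicontinuous phi ;
  divergence1 : phi 1%R = 0 ;
  divergence_lt0 : forall x, (x < 0)%R -> phi x = +oo }.

Section dro.
Context d (T : measurableType d) (R : realType).
Variables (phi : R -> \bar R) (tau : R).

Definition dro_density (P : {measure set T -> \bar R}) : set (T -> R) :=
  [set zeta : T -> R | [/\ measurable_fun setT zeta, (forall w, (0 <= zeta w)%R),
      \int[P]_w (zeta w)%:E = 1 & \int[P]_w phi (zeta w) <= tau%:E]].

Definition dro (P : {measure set T -> \bar R}) (X : T -> R) : \bar R :=
  ereal_sup [set \int[P]_w (X w * zeta w)%:E | zeta in dro_density P].

End dro.

Section empirical.
Context d (T : measurableType d) (R : realType) (n : nat).
Variable x : 'I_n -> T.

(* For n = 0 this is the zero measure. *)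
Definition empirical (A : set T) : \bar R :=
  (n%:R^-1)%:E * \sum_(i < n) \d_(x i) A.

Let empirical0 : empirical set0 = 0.
Proof. by rewrite /empirical big1 ?mule0// => i _; rewrite measure0. Qed.

Let empirical_ge0 A : 0 <= empirical A.
Proof.
by apply: mule_ge0; [rewrite lee_fin invr_ge0|exact: sume_ge0].
Qed.

Let empirical_sigma_additive : semi_sigma_additive empirical.
Proof.
pose m k : {measure set T -> \bar R} := \d_(nth point [seq x i | i : 'I_n] k).
have empiricalE : empirical = (fun A => (n%:R^-1)%:E * msum m n A).
  apply/funext => A; rewrite /empirical /msum; congr (_ * _).
  apply: eq_bigr => i _; rewrite /m (nth_map i) ?size_enum_ord//.
  by rewrite nth_ord_enum.
have inv_ge0 : (0 <= n%:R^-1 :> R)%R by rewrite invr_ge0.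
rewrite empiricalE.
exact: (@measure_semi_sigma_additive _ _ _ (mscale (NngNum inv_ge0) (msum m n))).
Qed.

HB.instance Definition _ := isMeasure.Build _ _ _ empirical
  empirical0 empirical_ge0 empirical_sigma_additive.

Lemma empirical_setT : (0 < n)%N -> empirical setT = 1.
Proof.
move=> n0; rewrite /empirical (eq_bigr (fun=> 1))//; last first.
  by move=> i _; rewrite probability_setT.
rewrite sumEFin -EFinM big_const_ord iter_addr_0.
by rewrite mulVf// pnatr_eq0 -lt0n.
Qed.

End empirical.

Arguments empirical {d T R n} x A.

(* Independence of a finite family; since some of the A i may be the whole
   space, the product rule over the full index set covers all subfamilies. *)
Definition mutually_independent (d d' : measure_display)
    (W : measurableType d) (T : measurableType d') (R : realType)
    (Pr : probability W R) (n : nat) (Y : 'I_n -> {RV Pr >-> T}) :=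
  forall A : 'I_n -> set T, (forall i, measurable (A i)) ->
    Pr (\bigcap_i (Y i @^-1` A i)) = \prod_(i < n) Pr (Y i @^-1` A i).

Definition iid (d d' : measure_display)
    (W : measurableType d) (T : measurableType d') (R : realType)
    (Pr : probability W R) (P : probability T R) (n : nat)
    (Y : 'I_n -> {RV Pr >-> T}) :=
  mutually_independent Y /\
  forall i A, measurable A -> distribution Pr (Y i) A = P A.

(* The two-point space is bool with its discrete sigma-algebra;
   the second point is false. *)
Definition omega1 : bool := true.

Definition payoff (R : realType) (w : bool) : R :=
  if w == omega1 then 1%R else 0%R.

(* Main.v *)
(* Let zeta put mass r on omega1, i.e. take zeta = r / p at omega1 and
   zeta = (1 - r) / (1 - p) at omega2, with p = P(omega1).  Since phi grows at
   most linearly, the point omega1 contributes p * phi (r / p) = O(r) to the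
   divergence budget, uniformly in small p; the point omega2 contributes O(r) as
   well, by convexity on [1 - delta, 1].  Hence for r small enough zeta is
   feasible for all small p, and R(X) >= r.  On the other hand, no sample hits
   omega1 with probability (1 - p)^n >= 1 - n p >= 1 / 2, and then R_n(X) = 0. *)
Require Import Defs.
From HB Require Import structures.
From mathcomp Require Import all_boot all_order all_algebra.
From mathcomp Require Import all_classical all_reals all_analysis.
From mathcomp Require Import ring lra.

Import Order.TTheory GRing.Theory Num.Theory.
Import numFieldNormedType.Exports.

Local Open Scope classical_set_scope.
Local Open Scope ring_scope.
Local Open Scope ereal_scope.

Lemma ge0_integral_bool (R : realType) (mu : {measure set bool -> \bar R})
    (f : bool -> \bar R) : (forall b, 0 <= f b) ->
  \int[mu]_b f b = f true * mu [set true] + f false * mu [set false].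
Proof.
move=> f0; rewrite setT_bool ge0_integral_setU//=.
- have E b : \int[mu]_(x in [set b]) f x = f b * mu [set b].
    rewrite (eq_integral (fun=> f b)); first by rewrite integral_cst.
    by move=> x; rewrite inE => ->.
  by rewrite !E.
- by apply/disj_setPS => -[] [].
Qed.

Lemma bernoulli_ineq (R : realDomainType) (x : R) n :
  (0 <= x <= 1)%R -> (1 - n%:R * x <= (1 - x) ^+ n)%R.
Proof.
move=> /andP[x0 x1]; elim: n => [|n IH]; first by rewrite mul0r subr0 expr0.
rewrite exprS; apply: (@le_trans _ _ ((1 - x) * (1 - n%:R * x))%R); last first.
  by rewrite ler_wpM2l// subr_ge0.
have := mulr_ge0 (ler0n R n) (mulr_ge0 x0 x0).
rewrite -natr1; lra.
Qed.

Lemma probability_bool_false (R : realType) (P : probability bool R) (p : R) :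
  P [set true] = p%:E -> P [set false] = (1 - p)%:E.
Proof.
move=> Pp; have -> : [set false] = ~` [set true].
  by apply/seteqP; split => -[] //=.
by rewrite probability_setC// Pp.
Qed.

(** Convexity with weight [t = (1 - b) / delta] on [1 - delta] and the rest on [1], where [phi]
    vanishes. *)
Lemma divergence_le_chord (R : realType) (phi : R -> \bar R) (delta M b : R) :
  divergence phi -> (0 < delta)%R -> phi (1 - delta)%R = M%:E ->
  (1 - delta <= b <= 1)%R -> phi b <= ((1 - b) / delta * M)%:E.
Proof.
move=> dphi d0 phiM /andP[b1 b2]; set t := ((1 - b) / delta)%R.
have t01 : (0 <= t <= 1)%R.
  apply/andP; split; first by rewrite divr_ge0 ?subr_ge0// ltW.
  by rewrite ler_pdivrMr// mul1r lerBlDr -lerBlDl.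
have := divergence_convex dphi (1 - delta)%R 1%R t01.
rewrite phiM (divergence1 dphi) mule0 adde0 -EFinM.
suff -> : (t * (1 - delta) + (1 - t) * 1 = b)%R by [].
by rewrite /t; field; rewrite gt_eqF.
Qed.

Lemma dro_payoff_ge (R : realType) (phi : R -> \bar R) (tau r p : R)
    (P : probability bool R) :
  divergence phi -> (0 <= r <= 1)%R -> (0 < p < 1)%R -> P [set true] = p%:E ->
  phi (r / p)%R * p%:E + phi ((1 - r) / (1 - p))%R * (1 - p)%:E <= tau%:E ->
  r%:E <= dro phi tau P (payoff R).
Proof.
move=> dphi /andP[r0 r1] /andP[p0 p1] Pt cost.
have Pf := probability_bool_false _ _ _ Pt.
have q0 : (1 - p != 0)%R by rewrite gt_eqF// subr_gt0.
pose zeta b := if b then (r / p)%R else ((1 - r) / (1 - p))%R.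
have z0 b : (0 <= zeta b)%R.
  by case: b; rewrite /zeta divr_ge0// ?subr_ge0// ltW.
apply: ereal_sup_ubound; exists zeta; first split => //.
- rewrite ge0_integral_bool//= Pt Pf -!EFinM -EFinD; congr _%:E.
  by rewrite !divfK ?gt_eqF//; lra.
- by rewrite ge0_integral_bool/= ?Pt ?Pf// => b; exact: divergence_ge0.
- rewrite ge0_integral_bool/=.
    rewrite Pt /payoff/= mul1r mul0r mul0e adde0 -EFinM divfK//.
    by rewrite gt_eqF.
  by move=> b; rewrite lee_fin mulr_ge0// /payoff; case: ifP.
Qed.

(** The payoff vanishes outside a null set, so every feasible density yields 0. The constant density
    1 is feasible at cost [phi 1 = 0], which keeps the supremum from being that of the empty set.
    The statement takes a measure [mu], so that [empirical] can be plugged in. *)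
Lemma dro_payoff_eq0 (R : realType) (phi : R -> \bar R) (tau : R)
    (mu : {measure set bool -> \bar R}) :
  divergence phi -> (0 <= tau)%R -> mu [set true] = 0 -> mu [set false] = 1 ->
  dro phi tau mu (payoff R) = 0.
Proof.
move=> dphi tau0 mt mf.
have int0 (zeta : bool -> R) : (forall b, 0 <= zeta b)%R ->
    \int[mu]_w (payoff R w * zeta w)%:E = 0.
  move=> z0; rewrite ge0_integral_bool/=.
    by rewrite mt mf mule0 /payoff/= mul0r mul0e adde0.
  by move=> b; rewrite lee_fin mulr_ge0// /payoff; case: ifP.
rewrite /dro [X in ereal_sup X](_ : _ = [set 0]) ?ereal_sup1//.
apply/seteqP; split => [_ [zeta [_ z0 _ _] <-]|_ ->]; first exact: int0.
exists (fun=> 1%R); last exact: int0.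
split => //; rewrite ge0_integral_bool// ?mt ?mf ?mule0 ?add0e ?mule1//.
by rewrite (divergence1 dphi).
by move=> b; rewrite (divergence1 dphi).
Qed.

(** The quantitative core: [r] and [p0] are fixed before [p], so one [r] serves all small [p]. *)
Lemma exists_dro_density (R : realType) (phi : R -> \bar R) (tau delta : R) :
  divergence phi -> (0 < delta)%R -> phi (1 - delta)%R < +oo ->
  (exists l : R, (fun x : R => phi x * (x^-1)%:E) @ +oo%R --> l%:E) ->
  (0 < tau)%R ->
  exists r p0 : R, [/\ (0 < r <= 1)%R, (0 < p0 < 1)%R &
    forall p : R, (0 < p <= p0)%R ->
      phi (r / p)%R * p%:E + phi ((1 - r) / (1 - p))%R * (1 - p)%:E <= tau%:E].
Proof.
move=> dphi d0 phid [l phil] tau0.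
have phi0 := divergence_ge0 dphi.
have [M phiM] : exists M : R, phi (1 - delta)%R = M%:E.
  exists (fine (phi (1 - delta)%R)).
  by rewrite fineK// ge0_fin_numE.
have M0 : (0 <= M)%R by rewrite -lee_fin -phiM.
(* A slope strictly above the limit [l], and positive even when [l = 0]; thus [phi x <= L * x] for
   large [x]. *)
pose L : R := (`|l| + 1)%R.
have L0 : (0 < L)%R by rewrite ltr_wpDl.
have [A [_ phiA]] : \forall x \near +oo%R, phi x * (x^-1)%:E < L%:E.
  apply: (phil (fun y => y < L%:E)); apply: open_ereal_lt'.
  by rewrite lte_fin /L (le_lt_trans (ler_norm l))// ltrDl.
pose x0 : R := (`|A| + 1)%R.
have x01 : (1 <= x0)%R by rewrite lerDr.
have phix x : (x0 <= x)%R -> phi x <= (L * x)%:E.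
  move=> x0x; have xgt0 : (0 < x)%R by exact/lt_le_trans/x0x/lt_le_trans/x01.
  have /phiA/ltW : (A < x)%R.
    by rewrite (lt_le_trans _ x0x)// (le_lt_trans (ler_norm A))// ltrDl.
  by rewrite EFinM -lee_pdivrMr.
have K0 : (0 < L + M / delta)%R by rewrite ltr_wpDr// divr_ge0// ltW.
(* The bound [1 / 2] keeps [r] and [p] away from 1, [delta] keeps the density at the second point
   above [1 - delta], and the last term makes the total cost [r * (L + M / delta)] at most [tau]. *)
pose r : R := Num.min (Num.min (1 / 2) delta)%R (tau / (L + M / delta))%R.
have r0 : (0 < r)%R by rewrite !lt_min d0 divr_gt0//= divr_gt0.
have rh : (r <= 1 / 2)%R by rewrite !ge_min lexx.
have rd : (r <= delta)%R by rewrite !ge_min lexx !orbT.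
have rK : (r * (L + M / delta) <= tau)%R.
  by rewrite -ler_pdivlMr// ge_min lexx orbT.
(* For [p <= r / x0] the ratio [r / p] is at least [x0], where the linear bound holds; since
   [x0 >= 1], also [p <= r], whence [b <= 1] below. *)
exists r, (r / x0)%R.
have x0gt0 : (0 < x0)%R by exact: lt_le_trans x01.
have rx0 : (r / x0 <= r)%R by rewrite ler_pdivrMr// ler_peMr// ltW.
split; [lra|by rewrite divr_gt0//=; lra|move=> p /andP[p0 px0]].
have p1 : (0 < 1 - p)%R by lra.
set b := ((1 - r) / (1 - p))%R.
have br : (1 - r <= b)%R.
  rewrite /b ler_pdivlMr//.
  have : (0 <= (1 - r) * p)%R by rewrite mulr_ge0//; lra.
  lra.
have b1 : (b <= 1)%R by rewrite /b ler_pdivrMr//; lra.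
have phib : phi b <= (r / delta * M)%:E.
  apply: le_trans (divergence_le_chord _ _ _ _ b dphi d0 phiM _) _; first lra.
  by rewrite lee_fin ler_wpM2r// ler_wpM2r ?invr_ge0 ?(ltW d0)//; lra.
have phir : phi (r / p)%R * p%:E <= (L * r)%:E.
  rewrite -lee_pdivlMr// -EFinM -mulrA; apply: phix.
  by rewrite ler_pdivlMr// mulrC -ler_pdivlMr.
apply: (@le_trans _ _ (L * r + r / delta * M)%:E); last first.
  by rewrite lee_fin (le_trans _ rK)// mulrDr mulrC lerD2l mulrA mulrAC.
(* The weight [1 - p <= 1] on the nonnegative [phi b] is bounded by 1. *)
rewrite [leRHS]EFinD leeD// (le_trans _ phib)// -[leRHS]mule1.
by rewrite lee_wpmul2l// lee_fin; lra.
Qed.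

(** The sample vector takes finitely many values, so any event it determines is a finite union of
    cylinders. This covers the deviation event without studying [dro] as a function of the
    sample. *)
Lemma measurable_bool_family d (W : measurableType d) (R : realType)
    (Pr : probability W R) (n : nat) (Y : 'I_n -> {RV Pr >-> bool})
    (A : set ('I_n -> bool)) : measurable [set w | A (fun i => Y i w)].
Proof.
rewrite (_ : [set _ | _] = \bigcup_(f in [set f : {ffun 'I_n -> bool} | A f])
   \bigcap_(i in setT) (Y i @^-1` [set f i])).
  apply: fin_bigcup_measurable => [|f _]; first exact: finite_finset.
  apply: fin_bigcap_measurable => [|i _]; first exact: finite_finset.
  by rewrite -[X in measurable X]setTI; exact: measurable_funPT.
apply/seteqP; split => [w Aw|w [f /= Af fY]] /=.
  exists [ffun i => Y i w] => [/=|i _/=]; last by rewrite ffunE.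
  suff -> : fun_of_fin [ffun i => Y i w] = fun i => Y i w by [].
  by apply/funext => i/=; rewrite ffunE.
by rewrite (_ : (fun i => Y i w) = f)//; apply/funext => i; exact: fY.
Qed.

Theorem theorem2p1 (R : realType) (phi : R -> \bar R) (tau : R)
    (phi_div : divergence phi)
    (phi_dom : exists2 delta : R, (0 < delta)%R &
       `[(1 - delta)%R, (1 + delta)%R] `<=` (edom phi)°)
    (phi_lim : exists l : R,
       (fun x : R => phi x * (x^-1)%:E) @ +oo%R --> l%:E)
    (tau_gt0 : (0 < tau)%R) :
  exists r p0 : R, [/\ (0 < r)%R, (0 < p0)%R,
    (forall P : probability bool R,
       0 < P [set omega1] -> P [set omega1] <= p0%:E ->
       r%:E <= dro phi tau P (payoff R)) &
    (forall p : R, (0 < p < p0)%R ->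
       exists P : probability bool R,
       forall n : nat, (0 < n)%N -> (n%:R <= 1 / (2 * p))%R ->
       forall (d : measure_display) (W : measurableType d)
         (Pr : probability W R) (Y : 'I_n -> {RV Pr >-> bool}),
         iid P Y ->
         (1 / 2)%:E <= Pr [set w |
           r%:E <= `| dro phi tau (empirical (fun i => Y i w)) (payoff R)
                      - dro phi tau P (payoff R) |])].
Proof.
have [delta delta0 sub_dom] := phi_dom.
have phid : phi (1 - delta)%R < +oo.
  apply: (interior_subset (sub_dom (1 - delta)%R _)).
  by rewrite /= in_itv/=; lra.
have [r [p0 [/andP[r0 r1] /andP[p00 p01] cost]]] :=
  exists_dro_density _ _ _ _ phi_div delta0 phid phi_lim tau_gt0.
have dro_ge (P : probability bool R) : 0 < P [set true] ->
    P [set true] <= p0%:E -> r%:E <= dro phi tau P (payoff R).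
  have [p Pp] : exists p, P [set true] = p%:E.
    by exists (fine (P [set true])); rewrite fineK// fin_num_measure.
  rewrite Pp lte_fin lee_fin => p_gt0 pp0.
  apply: dro_payoff_ge Pp _ => //; [lra|lra|].
  by apply: cost; rewrite p_gt0.
exists r, p0; split => // p /andP[p_gt0 pp0].
have p1 : (0 <= p <= 1)%R by lra.
(* The Bernoulli law is chosen before [n], so a single [P] serves all sample sizes. *)
exists (bernoulli_prob p) => n n0 np d W Pr Y [indep ident].
have Pt : bernoulli_prob p [set true] = p%:E.
  rewrite bernoulli_probE// !diracE mem_set// memNset//=.
  by rewrite mule1 mule0 adde0.
have Pf := probability_bool_false _ _ _ Pt.
have allf : Pr (\bigcap_i (Y i @^-1` [set false])) = ((1 - p) ^+ n)%:E.
  rewrite (indep (fun=> [set false]))//.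
  rewrite (eq_bigr (fun=> (1 - p)%:E)) => [|i _].
    by rewrite prodEFin prodr_const card_ord.
  by rewrite -Pf -(ident i).
(* The event that no sample hits [omega1] has probability at least [1 - n * p >= 1 / 2], and it is
   contained in the deviation event. *)
apply: (@le_trans _ _ (Pr (\bigcap_i (Y i @^-1` [set false])))).
  rewrite allf lee_fin; apply: le_trans (bernoulli_ineq _ _ n p1).
  suff : (n%:R * p <= 1 / 2)%R by lra.
  apply: (@le_trans _ _ (1 / (2 * p) * p)%R); first by rewrite ler_wpM2r// ltW.
  by rewrite le_eqVlt; apply/orP; left; apply/eqP; field; rewrite gt_eqF.
apply: le_measure; rewrite ?inE.
- apply: fin_bigcap_measurable => [|i _]; first exact: finite_finset.
  by rewrite -[X in measurable X]setTI; exact: measurable_funPT.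
- exact: (measurable_bool_family _ _ _ _ _ Y (fun y => r%:E <=
    `| dro phi tau (empirical y) (payoff R)
       - dro phi tau (bernoulli_prob p) (payoff R) |)).
(* Here the empirical measure is the Dirac mass at [false], so its [dro] is 0 and the deviation is
   the absolute value of the true [dro], which is at least [r]. *)
- move=> w /= Yw.
  rewrite (dro_payoff_eq0 _ _ _ _ phi_div (ltW tau_gt0)).
  + rewrite sub0e abseN (le_trans _ (lee_abs _))//.
    by apply: dro_ge; rewrite [_ [set true]]Pt// lee_fin ltW.
  + rewrite /= /empirical big1 ?mule0// => i _.
    by rewrite diracE memNset//= => Yt; have := Yw i I; rewrite /= Yt.
  (* All samples lie in [[set false]], so its mass is the total mass, which is 1 because [n] is
     positive. *)
  + rewrite -(empirical_setT R (fun i => Y i w) n0)/= /empirical; congr (_ * _).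
    apply: eq_bigr => i _; rewrite !diracE !mem_set//; exact: (Yw i I).
Qed.
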